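(* Let $n$ and $\omega$ be positive integers with $\lfloor 3n/4\rfloor\le\omega\le n-1$, and let $\mathbf{u}$ be a binary sequence with least period $n$. Then $nlc(\mathbf{u})=\omega$ if and only if some block of $n$ consecutive terms of $\mathbf{u}$, written $\mathbf{s}_n=(s_0,s_1,\dots,s_{n-1})$, has one of the following two forms. (i) For some $d$ with $1\le d\le n-\omega-1$: $$\mathbf{s}_n=\big((s_0,\dots,s_{d-1})^{q}\,(s_0,\dots,s_{r-1},\overline{s_r})\,(s_{\omega+d},\dots,s_{n-2})\,\overline{s_{d-1}}\big),$$ where the first part $(s_0,\dots,s_{d-1})^{q}(s_0,\dots,s_{r-1},\overline{s_r})$ has length $\omega+d$, $q=\lfloor(\omega+d-1)/d\rfloor$, $0\le r=(\omega+d-1)-qd<d$, $\mathbf{s}_d=(s_0,\dots,s_{d-1})$ is aperiodic, the block $(s_{\omega+d},\dots,s_{n-2})$ is an arbitrary element of $\mathbb{Z}_2^{\,n-\omega-d-1}$, and the last term is $s_{n-1}=\overline{s_{d-1}}$. (ii) For some $d$ with $n-\omega\le d\le\lfloor n/2\rfloor$: $$\mathbf{s}_n=\big((s_0,\dots,s_{d-1})^{q'}\,(s_0,\dots,s_{r'-1},\overline{s_{r'}})\big),$$ where $q'=\lfloor (n-1)/d\rfloor$, $0\le r'=(n-1)-q'd<d$, and the aperiodic sequence $\mathbf{s}_d=(s_0,\dots,s_{d-1})$ satisfies, with $t=\omega+d-n$: if $t=0$ then $s_{(n-1)\bmod d}=s_{d-1}$; if $t>0$ then $\overline{s_{(n-1)\bmod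 d}}=s_{d-1}$, $s_{(n-i)\bmod d}=s_{(d-i)\bmod d}$ for $2\le i\le t$, and $s_{(n-t-1)\bmod d}=\overline{s_{(d-t-1)\bmod d}}$.
   Context: All sequences are binary, with entries in $\mathbb{Z}_2$, and $\overline{x}=x\oplus1$. For a finite sequence $\mathbf{a}$ and an integer $q\ge1$, $\mathbf{a}^q$ is the concatenation of $q$ copies of $\mathbf{a}$; juxtaposition of blocks denotes concatenation. A finite sequence of length $m$ is periodic if it equals $\mathbf{a}^{m/e}$ for some sequence $\mathbf{a}$ of length $e$, $e$ a proper divisor of $m$; otherwise it is aperiodic. $x\bmod d$ denotes the least nonnegative residue. The nonlinear complexity $nlc(\mathbf{u})$ of a (finite or infinite) sequence $\mathbf{u}=(u_0,u_1,\dots)$ is the length of the shortest feedback shift register generating it, i.e. the least integer $L\ge0$ for which there is a function $f:\mathbb{Z}_2^L\to\mathbb{Z}_2$ with $u_{i+L}=f(u_i,\dots,u_{i+L-1})$ for all $i$ for which $u_{i+L}$ is defined. *)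

(* Defs.v *)
From mathcomp Require Import all_boot.
Set Implicit Arguments. Unset Strict Implicit. Unset Printing Implicit Defensive.

Definition rep (a : seq bool) (q : nat) : seq bool := flatten (nseq q a).

Definition periodic_seq (a : seq bool) : Prop :=
  exists e : nat, exists b : seq bool,
    [/\ e %| size a, e < size a, size b = e & a = rep b (size a %/ e)].
Definition aperiodic_seq (a : seq bool) : Prop := ~ periodic_seq a.

Definition least_period (u : nat -> bool) (n : nat) : Prop :=
  0 < n /\ (forall i, u (i + n) = u i) /\
  (forall m, 0 < m -> m < n -> ~ (forall i, u (i + m) = u i)).

Definition fsr_generates (L : nat) (u : nat -> bool) : Prop :=
  exists f : L.-tuple bool -> bool,
    forall i, u (i + L) = f [tuple u (i + val k) | k < L].

Definition nlc_is (u : nat -> bool) (L : nat) : Prop :=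
  fsr_generates L u /\ forall L', L' < L -> ~ fsr_generates L' u.

Definition block (u : nat -> bool) (k n : nat) : seq bool :=
  [seq u (k + i) | i <- iota 0 n].

Definition form_i (n w : nat) (s : seq bool) : Prop :=
  exists d : nat, [/\ 1 <= d, d <= n - w - 1,
    aperiodic_seq (take d s) &
    let q := (w + d - 1) %/ d in
    let r := (w + d - 1) - q * d in
    s = rep (take d s) q ++ rcons (take r s) (~~ nth false s r)
        ++ drop (w + d) (take (n - 1) s) ++ [:: ~~ nth false s (d - 1)]].

Definition form_ii (n w : nat) (s : seq bool) : Prop :=
  exists d : nat, [/\ n - w <= d, d <= n %/ 2,
    aperiodic_seq (take d s),
    (let q' := (n - 1) %/ d in
     let r' := (n - 1) - q' * d in
     s = rep (take d s) q' ++ rcons (take r' s) (~~ nth false s r')) &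
    let t := w + d - n in
    let sd := fun j => nth false (take d s) j in
    (t = 0 -> sd ((n - 1) %% d) = sd (d - 1)) /\
    (0 < t ->
       [/\ ~~ sd ((n - 1) %% d) = sd (d - 1),
           (forall i, 2 <= i -> i <= t -> sd ((n - i) %% d) = sd ((d - i) %% d)) &
           sd ((n - t - 1) %% d) = ~~ sd ((d - t - 1) %% d)])].

(* Main.v *)
Require Import Defs.
From mathcomp Require Import all_boot.
From mathcomp Require Import zify.
From Stdlib Require Import Classical_Prop.
Set Implicit Arguments. Unset Strict Implicit. Unset Printing Implicit Defensive.

(** Complexity [w] means that some word of length [w - 1] occurs at two
    positions with different successors, while no word of length [w] does.
    Taking the distance [d] of the two positions modulo [n], with
    [2 * d <= n], gives a maximal window of length [w + d - 1] with period [d]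
    and no smaller period dividing [d].  Forms (i) and (ii) describe such a
    window according to whether it leaves room in a block of length [n].

    Conversely, given such a window, suppose that a word of length at least [w]
    is repeated at distance [e], i.e. there is a window of length [W + e] with
    period [e] and [w <= W].  If the two windows overlap in at least
    [d + e - gcd d e] places, Fine and Wilf's theorem contradicts the
    primitivity of [d].  Otherwise let [a x = u x + u (x + d)] and
    [b x = u x + u (x + e)] over Z_2.  Both are supported in arcs of length at
    most [n - w + 1], about [n / 4], and [a x + a (x + e) = b x + b (x + d)];
    evaluating this at the ends of the two arcs is contradictory. *)

(** * Local periods on a window, up to Fine and Wilf *)

Definition per (u : nat -> bool) (lo hi p : nat) : Prop :=
  forall k, lo <= k -> k + p < hi -> u (k + p) = u k.

Lemma perW u lo hi lo' hi' p :
  lo <= lo' -> hi' <= hi -> per u lo hi p -> per u lo' hi' p.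
Proof. by move=> hlo hhi Hp k hk1 hk2; apply: Hp; lia. Qed.

Lemma per_eqmod u lo hi p x y : 0 < p -> per u lo hi p ->
  lo <= x < hi -> lo <= y < hi -> x = y %[mod p] -> u x = u y.
Proof.
move=> p0 Hp.
have up q z : lo <= z -> z + q * p < hi -> u (z + q * p) = u z.
  move=> hz; elim: q => [|q IH]; first by rewrite mul0n addn0.
  by rewrite mulSnr addnA => h; rewrite Hp ?IH; lia.
wlog le_xy : x y / x <= y.
  by move=> W hx hy E; case/orP: (leq_total x y) => ?; [|symmetry]; apply: W.
move=> hx hy /eqP; rewrite eq_sym eqn_mod_dvd // => /dvdnP [q E].
have Ey : y = x + q * p by lia.
by rewrite Ey up //; lia.
Qed.

(** The inner window has length at least [p], so it meets every class modulo [p]. Moving [k] and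
    [k + g] into it along [p] keeps their values, and keeps them congruent modulo [g] because [g]
    divides [p]. *)
Lemma per_dvd u lo hi p lo' hi' g : 0 < p -> g %| p ->
  lo <= lo' -> lo' + p <= hi' -> hi' <= hi ->
  per u lo hi p -> per u lo' hi' g -> per u lo hi g.
Proof.
move=> p0 gp h1 h2 h3 Hp Hg k hk1 hk2.
have g0 := dvdn_gt0 p0 gp.
have rep_in z : lo <= z < hi ->
    exists z', [/\ lo' <= z' < hi', z' = z %[mod p] & u z' = u z].
  (* This is [lo' + (z - lo') %% p]; the multiple [lo' * p] keeps the subtraction exact in [nat]. *)
  move=> hz; exists (lo' + (z + (lo' * p - lo')) %% p).
  have lt := ltn_pmod (z + (lo' * p - lo')) p0.
  have E : lo' + (z + (lo' * p - lo')) %% p = z %[mod p].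
    rewrite modnDmr; have -> : lo' + (z + (lo' * p - lo')) = lo' * p + z by nia.
    by rewrite modnMDl.
  by split=> //; [lia | apply: per_eqmod Hp _ _ E => //; lia].
have [x [hx Ex <-]] :
    exists z', [/\ lo' <= z' < hi', z' = k + g %[mod p] & u z' = u (k + g)].
  by apply: rep_in; lia.
have [y [hy Ey <-]] :
    exists z', [/\ lo' <= z' < hi', z' = k %[mod p] & u z' = u k].
  by apply: rep_in; lia.
apply: per_eqmod Hg hx hy _ => //.
by rewrite -(modn_dvdm x gp) Ex -(modn_dvdm y gp) Ey !(modn_dvdm _ gp) modnDr.
Qed.

(* Fine and Wilf. *)
Lemma per_gcd u lo hi p q : 0 < p -> 0 < q -> lo + p + q <= hi + gcdn p q ->
  per u lo hi p -> per u lo hi q -> per u lo hi (gcdn p q).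
Proof.
have [N le_N] := ubnP (p + q); elim: N hi p q le_N => // N IH hi p q le_N.
wlog le_pq : p q le_N / p <= q.
  move=> W p0 q0 hL Hp Hq; case/orP: (leq_total p q) => le; first exact: W.
  by rewrite gcdnC; apply: W => //; [lia | rewrite gcdnC; lia].
move=> p0 q0; case: (ltngtP p q) le_pq => // [lt_pq _ | <- _]; last by rewrite gcdnn.
have Eg : gcdn p q = gcdn p (q - p).
  by rewrite -{1}(subnKC (ltnW lt_pq)) gcdnDl.
rewrite Eg => hL Hp Hq.
have g0 : 0 < gcdn p (q - p) by rewrite gcdn_gt0 p0.
have gq : gcdn p (q - p) <= q - p by apply: dvdn_leq (dvdn_gcdr _ _); lia.
(* Euclid by subtraction: [q - p] is a period once the last [p] places are dropped. What remains
   still has length at least [p], so the gcd period found there extends back. *)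
apply: (@per_dvd u lo hi p lo (hi - p)) => //; rewrite ?dvdn_gcdl //; try lia.
apply: IH => //; try lia.
  by apply: perW Hp; lia.
move=> k hk1 hk2.
have <- : u (k + (q - p) + p) = u (k + (q - p)) by apply: Hp; lia.
have -> : k + (q - p) + p = k + q by lia.
by apply: Hq; lia.
Qed.

(** * Complexity as determination of the next letter *)

Definition determines (u : nat -> bool) (L : nat) : Prop :=
  forall i j, (forall k, k < L -> u (i + k) = u (j + k)) -> u (i + L) = u (j + L).

Lemma periodic_addM (u : nat -> bool) n x q :
  (forall i, u (i + n) = u i) -> u (x + q * n) = u x.
Proof.
by move=> un; elim: q => [|q IH]; rewrite ?addn0 // mulSnr addnA un.
Qed.

Lemma periodic_mod (u : nat -> bool) n x :
  (forall i, u (i + n) = u i) -> u (x %% n) = u x.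
Proof.
by move=> un; rewrite {2}(divn_eq x n) addnC periodic_addM.
Qed.

Lemma fsr_generatesP (u : nat -> bool) n L : 0 < n -> (forall i, u (i + n) = u i) ->
  fsr_generates L u <-> determines u L.
Proof.
move=> n0 un; split.
  case=> f Hf i j H; rewrite !Hf; apply: (congr1 f).
  by apply: eq_from_tnth => k; rewrite !tnth_mktuple H ?ltn_ord.
move=> H.
(* The feedback is true when some occurrence of [t] is followed by true. By periodicity the
   positions below [n] suffice, which makes the search boolean. *)
exists (fun t : L.-tuple bool =>
  [exists i : 'I_n, (t == [tuple u (val i + val k) | k < L]) && u (val i + L)]).
move=> i; apply/idP/existsP => [Hu | [j /andP [/eqP E Hu]]].
  exists (Ordinal (ltn_pmod i n0)) => /=; apply/andP; split.
    apply/eqP/eq_from_tnth => k; rewrite !tnth_mktuple.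
    by rewrite -(periodic_mod (i + k) un) -(periodic_mod (i %% n + k) un) modnDml.
  by rewrite -(periodic_mod (i %% n + L) un) modnDml periodic_mod.
rewrite (H i j) // => k hk.
by have := congr1 (fun t => tnth t (Ordinal hk)) E; rewrite !tnth_mktuple.
Qed.

Lemma determinesS u L L' : L <= L' -> determines u L -> determines u L'.
Proof.
move=> le H i j E.
have -> : i + L' = i + (L' - L) + L by lia.
have -> : j + L' = j + (L' - L) + L by lia.
apply: H => k hk; rewrite -!addnA; apply: E; lia.
Qed.

(** By monotonicity in the length, [w - 1] stands for all [L' < w]. *)
Lemma nlc_isP (u : nat -> bool) n w : 0 < n -> 0 < w -> (forall i, u (i + n) = u i) ->
  nlc_is u w <-> determines u w /\ ~ determines u (w - 1).
Proof.
move=> n0 w0 un; have P L := fsr_generatesP L n0 un.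
split=> [[/P H1 H2]|[H1 H2]]; first by split=> // /P; apply: H2; lia.
split; first exact/P.
by move=> L' lt /P H; apply/H2/(determinesS _ H); lia.
Qed.

Lemma determines_forever u L i j : determines u L ->
  (forall k, k < L -> u (i + k) = u (j + k)) -> forall k, u (i + k) = u (j + k).
Proof.
move=> H E k; have [N] := ubnP k; elim: N k => // N IH k ltk.
case: (ltnP k L) => [|le]; first exact: E.
have -> : i + k = i + (k - L) + L by lia.
have -> : j + k = j + (k - L) + L by lia.
apply: H => k' hk'; rewrite -!addnA; apply: IH; lia.
Qed.

(** * From a repeated word with two successors to a maximal window *)

Lemma not_determines u L : ~ determines u L ->
  exists i j, (forall k, k < L -> u (i + k) = u (j + k)) /\ u (i + L) <> u (j + L).
Proof.
move=> H; apply: NNPP => H'; apply: H => i j E; apply: NNPP => D.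
by apply: H'; exists i, j.
Qed.

(** The two positions are reduced modulo [n] and ordered as [i' < j']. If [j' - i'] exceeds half of
    [n], the word is read at [j'] and then at [i' + n] instead. *)
Lemma not_determines_shift u n L : 0 < n -> (forall i, u (i + n) = u i) ->
  ~ determines u L -> exists i d, [/\ 0 < d, 2 * d <= n,
    per u i (i + L + d) d & u (i + L) <> u (i + L + d)].
Proof.
move=> n0 un /not_determines [i [j [E D]]].
have um x y : u (x %% n + y) = u (x + y).
  by rewrite -(periodic_mod (x + y) un) -(periodic_mod (x %% n + y) un) modnDml.
have {E D} [i' [j' [lt hj E D]]] : exists i' j', [/\ i' < j', j' < n,
   (forall k, k < L -> u (i' + k) = u (j' + k)) & u (i' + L) <> u (j' + L)].
  have hi := ltn_pmod i n0; have hj := ltn_pmod j n0.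
  case: (ltngtP (i %% n) (j %% n)) => c.
  - exists (i %% n), (j %% n); split=> // [k hk|]; rewrite !um //; exact: E.
  - exists (j %% n), (i %% n); split=> // [k hk|]; rewrite !um //;
      [symmetry; exact: E | exact: nesym].
  - by case: D; rewrite -um c um.
case: (leqP (2 * (j' - i')) n) => c.
  exists i', (j' - i'); split=> //; first lia.
    move=> k hk1 hk2.
    have -> : k + (j' - i') = j' + (k - i') by lia.
    by rewrite -E; [congr u; lia | lia].
  by have -> : i' + L + (j' - i') = j' + L by lia.
exists j', (n - (j' - i')); split; try lia.
  move=> k hk1 hk2.
  have -> : k + (n - (j' - i')) = i' + (k - j') + n by lia.
  by rewrite un E; [congr u; lia | lia].
have -> : j' + L + (n - (j' - i')) = i' + L + n by lia.
by rewrite un; apply: nesym.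
Qed.

(* The window of period [d] starts at [i] and has length [w + d - 1]; the two
   inequalities say that it extends neither to the right nor, reading indices
   modulo [n], to the left. *)
Definition core (u : nat -> bool) (n w i d : nat) : Prop :=
  [/\ per u i (i + w + d - 1) d,
      u (i + w - 1) <> u (i + w - 1 + d),
      u (i + n - 1) <> u (i + n - 1 + d) &
      forall g, g %| d -> g < d -> ~ per u i (i + w + d - 1) g].

(** Without a mismatch on the left, two equal words of length [w] would have different successors. A
    smaller period [g] would repeat a word of length [w] at distance [g], and determination would
    spread it to all of [u]. *)
Lemma nlc_core u n w : 0 < w -> least_period u n ->
  determines u w -> ~ determines u (w - 1) ->
  exists i d, [/\ 0 < d, 2 * d <= n & core u n w i d].
Proof.
move=> w0 [n0 [un minn]] Hw /(not_determines_shift n0 un) [i [d [d0 hd Hp D]]].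
exists i, d; split=> //.
have Hp' : per u i (i + w + d - 1) d by apply: perW Hp; lia.
have D' : u (i + w - 1) <> u (i + w - 1 + d).
  by have -> : i + w - 1 = i + (w - 1) by lia.
split=> //.
  move=> E; apply: D'.
  have {1}-> : u (i + w - 1) = u (i + n - 1 + w).
    by rewrite -un; congr u; lia.
  have -> : u (i + w - 1 + d) = u (i + n - 1 + d + w).
    by rewrite -un; congr u; lia.
  (* [i + n - 1] stands for [i - 1]: the first letters agree by [E], the others by the period of the
     window. *)
  apply: Hw => -[|k] hk; first by rewrite !addn0.
  have -> : i + n - 1 + k.+1 = i + k + n by lia.
  have -> : i + n - 1 + d + k.+1 = i + k + d + n by lia.
  by rewrite !un Hp'; lia.
move=> g gd ltg Hg.
have g0 : 0 < g by case: (posnP g) gd d0 => // ->; rewrite dvd0n => /eqP ->.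
have le2 : 2 * g <= d by case/dvdnP: gd ltg d0 => -[|[|q]] ->; nia.
have F : forall k, u (i + k) = u (i + g + k).
  apply: (determines_forever Hw) => k hk.
  have -> : i + g + k = i + k + g by lia.
  by rewrite Hg; lia.
apply: (minn g) => // [|x]; first lia.
(* Adding [i * n] keeps the subtraction exact when [x < i]. *)
have := F (x + i * n - i).
have -> : i + (x + i * n - i) = x + i * n by nia.
have -> : i + g + (x + i * n - i) = x + g + i * n by nia.
by rewrite !periodic_addM.
Qed.

(** * Powers, aperiodic words and the two forms of a block *)

Lemma size_rep a q : size (rep a q) = q * size a.
Proof. by elim: q => //= q IH; rewrite size_cat -/(rep a q) IH mulSn. Qed.

Lemma nth_rep a q k : k < q * size a -> nth false (rep a q) k = nth false a (k %% size a).
Proof.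
elim: q k => //= q IH k; rewrite mulSn => hk; rewrite nth_cat -/(rep a q).
case: ltnP => le; first by rewrite modn_small.
rewrite IH; last by lia.
by rewrite -{2}(subnK le) modnDr.
Qed.

Lemma aperiodic_seqP (a : seq bool) : aperiodic_seq a <->
  forall g, g %| size a -> g < size a -> ~ per (nth false a) 0 (size a) g.
Proof.
split=> [H g gd lt Hg | H [e [b [ed lt sb E]]]].
  have g0 : 0 < g by apply: dvdn_gt0 gd; lia.
  apply: H; exists g, (take g a); split=> //; first by rewrite size_takel // ltnW.
  have sg : size (take g a) = g by rewrite size_takel // ltnW.
  apply: (@eq_from_nth _ false) => [|k hk]; first by rewrite size_rep sg divnK.
  rewrite nth_rep sg ?divnK // nth_take ?ltn_pmod //.
  apply: (per_eqmod g0 Hg); rewrite ?modn_mod //.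
  by have := ltn_pmod k g0; lia.
apply: (H e) => // k _ hk.
rewrite E !nth_rep ?sb ?divnK //; first by rewrite modnDr.
by lia.
Qed.

(** [N] is the index of the flipped letter: [w + d - 1] in form (i), [n - 1] in form (ii). Before
    it, letter [k] of the left side is [s] at [k %% d], so the equation says that period [d] holds
    before [N] and breaks there. *)
Lemma rep_prefixP (s : seq bool) d N : 0 < d -> d <= N -> N < size s ->
  let q := N %/ d in let r := N - q * d in
  rep (take d s) q ++ rcons (take r s) (~~ nth false s r) = take N.+1 s <->
  per (nth false s) 0 N d /\ nth false s N <> nth false s (N - d).
Proof.
move=> d0 dN Ns q r; set P := _ ++ _.
have Er : r = N %% d by rewrite /r {1}(divn_eq N d) addKn.
have rd : r < d by rewrite Er ltn_pmod.
have EN : N = q * d + r by rewrite Er; exact: divn_eq.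
have sd : size (take d s) = d by rewrite size_takel //; lia.
have sr : size (take r s) = r by rewrite size_takel //; lia.
have sP : size P = N.+1 by rewrite size_cat size_rep size_rcons sd sr; lia.
have nP k : k < N -> nth false P k = nth false s (k %% d).
  move=> hk; rewrite nth_cat size_rep sd; case: ltnP => le.
    by rewrite nth_rep sd // nth_take // ltn_pmod.
  rewrite nth_rcons sr ifT; last by lia.
  rewrite nth_take; last by lia.
  by rewrite -{2}(subnK le) addnC modnMDl modn_small //; lia.
have nPN : nth false P N = ~~ nth false s (N %% d).
  rewrite nth_cat size_rep sd ifF; last by lia.
  have -> : N - q * d = r by [].
  by rewrite nth_rcons sr ltnn eqxx Er.
have EP : P = take N.+1 s <->
    (forall k, k < N -> nth false s (k %% d) = nth false s k) /\
    ~~ nth false s (N %% d) = nth false s N.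
  split=> [E | [E1 E2]].
    split=> [k hk|]; first by rewrite -nP // E nth_take //; lia.
    by rewrite -nPN E nth_take.
  apply: (@eq_from_nth _ false) => [|k]; rewrite sP ?size_takel // => hk.
  rewrite nth_take //; case: (ltngtP k N) => [lt|gt|->]; last by rewrite nPN.
    by rewrite nP // E1.
  by lia.
rewrite EP.
have Emod : (forall k, k < N -> nth false s (k %% d) = nth false s k) ->
    nth false s (N %% d) = nth false s (N - d).
  move=> H; rewrite -(H (N - d)); last by lia.
  by rewrite -{1}(subnK dN) modnDr.
split=> [[H1 H2] | [H1 H2]].
  split; last by rewrite -H2 Emod //; case: (nth _ _ _).
  by move=> k _ hk; rewrite -(H1 (k + d)) // modnDr H1 //; lia.
have H k : k < N -> nth false s (k %% d) = nth false s k.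
  move=> hk; apply: (per_eqmod d0 H1); rewrite ?modn_mod //.
  by have := ltn_pmod k d0; lia.
by split=> //; rewrite Emod //; move: H2; do 2!case: (nth _ _ _).
Qed.

Lemma size_block u k n : size (block u k n) = n.
Proof. by rewrite size_map size_iota. Qed.

Lemma nth_block u k n i : i < n -> nth false (block u k n) i = u (k + i).
Proof. by move=> hi; rewrite (nth_map 0) ?size_iota // nth_iota. Qed.

(** By [per_dvd], any [d] consecutive places of the window detect a period dividing [d]. The offset
    [t] is [0] for form (i) and [w + d - n] for form (ii). *)
Lemma aperiodic_blockP u i L d t n :
  0 < d -> per u i (i + L) d -> t + d <= L -> d <= n ->
  aperiodic_seq (take d (block u (i + t) n)) <->
  forall g, g %| d -> g < d -> ~ per u i (i + L) g.
Proof.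
move=> d0 Hp ht dn.
have sd : size (take d (block u (i + t) n)) = d.
  by rewrite size_takel // size_block.
rewrite aperiodic_seqP sd.
have nt k : k < d -> nth false (take d (block u (i + t) n)) k = u (i + t + k).
  by move=> hk; rewrite nth_take // nth_block //; lia.
split=> H g gd lt Hg; apply: (H g gd lt).
  move=> k _ hk; rewrite !nt //; last by lia.
  by rewrite addnA Hg //; lia.
apply: (per_dvd d0 gd _ _ _ Hp (lo' := i + t) (hi' := i + t + d)); try lia.
move=> k hk1 hk2.
have := Hg (k - (i + t)) isT; rewrite !nt; try lia.
have -> : i + t + (k - (i + t) + g) = k + g by lia.
have -> : i + t + (k - (i + t)) = k by lia.
by apply; lia.
Qed.

Lemma neq_bool (a b : bool) : a <> b <-> a = ~~ b.
Proof. by case: a; case: b. Qed.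

(** The arbitrary middle part copies [s] onto itself, so only the prefix and the last letter are
    constrained. *)
Lemma cat_drop_takeP (T : Type) (s P : seq T) m x : size P = m -> m < size s ->
  s = P ++ drop m (take (size s - 1) s) ++ [:: x] <->
  P = take m s /\ (forall x0, nth x0 s (size s - 1) = x).
Proof.
move=> sP ms; set S := size s - 1.
have sS : S < size s by rewrite /S; lia.
have Es y : s = take m s ++ drop m (take S s) ++ [:: nth y s S].
  have E1 : take m (take S s) = take m s by rewrite take_takel //; lia.
  rewrite catA -{1}E1 cat_take_drop cats1 -take_nth // /S.
  by rewrite take_oversize //; lia.
split=> [E | [-> H]].
  split=> [|y]; first by rewrite {1}E take_cat sP ltnn subnn take0 cats0.
  have sdr : size (drop m (take S s)) = S - m by rewrite size_drop size_takel //; lia.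
  rewrite E nth_cat sP ifF; last by lia.
  by rewrite nth_cat sdr ltnn subnn.
by rewrite -(H x); exact: Es.
Qed.

(** The window and its right mismatch fill the first [w + d] places. The last place of the block
    precedes the window modulo [n], so flipping [s_{d-1}] there is the left mismatch. *)
Lemma form_iP u n w d i : 0 < w -> 0 < d -> w + d < n -> (forall i, u (i + n) = u i) ->
  let s := block u i n in
  let q := (w + d - 1) %/ d in let r := (w + d - 1) - q * d in
  (aperiodic_seq (take d s) /\
    s = rep (take d s) q ++ rcons (take r s) (~~ nth false s r)
        ++ drop (w + d) (take (n - 1) s) ++ [:: ~~ nth false s (d - 1)]) <->
  core u n w i d.
Proof.
move=> w0 d0 lt un s q r.
have ss : size s = n := size_block _ _ _.
have dN : d <= w + d - 1 by lia.
have Ns : w + d - 1 < size s by lia.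
have := rep_prefixP d0 dN Ns; cbv zeta; rewrite -/q -/r.
have -> : (w + d - 1).+1 = w + d by lia.
have -> : w + d - 1 - d = w - 1 by lia.
set P := _ ++ rcons _ _ => EP.
have sP : size P = w + d.
  have hq : q * d <= w + d - 1 := leq_trunc_div _ _.
  have hr : r = w + d - 1 - q * d by [].
  by rewrite size_cat size_rep size_rcons !size_takel; lia.
have := @cat_drop_takeP _ s P (w + d) (~~ nth false s (d - 1)) sP.
rewrite ss => /(_ lt) ES.
rewrite [X in s = X]catA -/P ES EP.
have nE k : k < n -> nth false s k = u (i + k) by exact: nth_block.
have -> : (forall x0, nth x0 s (n - 1) = ~~ nth false s (d - 1)) <->
    u (i + n - 1) <> u (i + n - 1 + d).
  have -> : i + n - 1 + d = i + (d - 1) + n by lia.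
  rewrite un -nE; last by lia.
  have -> : i + n - 1 = i + (n - 1) by lia.
  rewrite -nE; last by lia.
  rewrite neq_bool; split=> // H x0.
  by rewrite (set_nth_default false) // ss; lia.
rewrite !nE; try lia.
have -> : u (i + (w + d - 1)) <> u (i + (w - 1)) <->
    u (i + w - 1) <> u (i + w - 1 + d).
  have -> : i + (w + d - 1) = i + w - 1 + d by lia.
  have -> : i + (w - 1) = i + w - 1 by lia.
  by split; exact: nesym.
have -> : per (nth false s) 0 (w + d - 1) d <-> per u i (i + w + d - 1) d.
  split=> H k hk1 hk2.
    have := H (k - i) isT; rewrite !nE; try lia.
    have -> : i + (k - i + d) = k + d by lia.
    have -> : i + (k - i) = k by lia.
    by apply; lia.
  by rewrite !nE ?addnA ?H //; lia.
have EA : per u i (i + w + d - 1) d -> aperiodic_seq (take d s) <->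
    forall g, g %| d -> g < d -> ~ per u i (i + w + d - 1) g.
  have -> : i + w + d - 1 = i + (w + d - 1) by lia.
  move=> Hp; rewrite -(@aperiodic_blockP u i (w + d - 1) d 0 n) ?addn0 //; lia.
by split=> [[A [[H1 H2] H3]] | [H1 H2 H3 A]]; do ?split=> //; apply/EA.
Qed.

(* Here the window may be longer than the block, which therefore starts
   [w + d - n] places into it, so as to end with the mismatch on the right. *)
Lemma form_iiP u n w d i : 0 < w < n -> 0 < d -> 2 * d <= n -> n <= w + d ->
  (forall i, u (i + n) = u i) ->
  let s := block u (i + (w + d - n)) n in
  [/\ aperiodic_seq (take d s),
    (let q' := (n - 1) %/ d in
     let r' := (n - 1) - q' * d in
     s = rep (take d s) q' ++ rcons (take r' s) (~~ nth false s r')) &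
    let t := w + d - n in
    let sd := fun j => nth false (take d s) j in
    (t = 0 -> sd ((n - 1) %% d) = sd (d - 1)) /\
    (0 < t ->
       [/\ ~~ sd ((n - 1) %% d) = sd (d - 1),
           (forall i, 2 <= i -> i <= t -> sd ((n - i) %% d) = sd ((d - i) %% d)) &
           sd ((n - t - 1) %% d) = ~~ sd ((d - t - 1) %% d)])] <->
  core u n w i d.
Proof.
move=> /andP [w0 wn] d0 dn nwd un s; cbv zeta.
set t := w + d - n.
have ss : size s = n := size_block _ _ _.
have dN : d <= n - 1 by lia.
have Ns : n - 1 < size s by lia.
have := rep_prefixP d0 dN Ns; cbv zeta.
have -> : (n - 1).+1 = n by lia.
rewrite (@take_oversize _ n s) ?ss //; set P := _ ++ _ => EP.
have nE k : k < n -> nth false s k = u (i + t + k) by exact: nth_block.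
have dE k : k < d -> nth false (take d s) k = u (i + t + k).
  by move=> hk; rewrite nth_take // nE //; lia.
have {EP} EP : s = P <-> per u (i + t) (i + t + n - 1) d /\
    u (i + t + n - 1) <> u (i + t + n - 1 - d).
  have -> : s = P <-> P = s by split=> ->.
  rewrite EP !nE; try lia.
  have -> : i + t + (n - 1) = i + t + n - 1 by lia.
  have -> : i + t + (n - 1 - d) = i + t + n - 1 - d by lia.
  have -> // : per (nth false s) 0 (n - 1) d <-> per u (i + t) (i + t + n - 1) d.
  split=> H k hk1 hk2.
    have := H (k - (i + t)) isT; rewrite !nE; try lia.
    have -> : i + t + (k - (i + t) + d) = k + d by lia.
    have -> : i + t + (k - (i + t)) = k by lia.
    by apply; lia.
  by rewrite !nE ?addnA ?H //; lia.
have EA : per u i (i + w + d - 1) d -> aperiodic_seq (take d s) <->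
    forall g, g %| d -> g < d -> ~ per u i (i + w + d - 1) g.
  have -> : i + w + d - 1 = i + (w + d - 1) by lia.
  by move=> Hp; rewrite -(@aperiodic_blockP u i (w + d - 1) d t n) //; lia.
have modE k : per u (i + t) (i + t + n - 1) d -> k < n - 1 ->
    nth false (take d s) (k %% d) = u (i + t + k).
  move=> H hk; rewrite dE ?ltn_pmod //.
  by apply: (per_eqmod d0 H); [lia | lia | rewrite modnDmr].
(* [modE] stops before [n - 1], where the period breaks; [n - 1 - d] has the same residue. *)
have lastE : (n - 1) %% d = (n - 1 - d) %% d by rewrite -{1}(subnK dN) modnDr.
have Et : t + n = w + d by rewrite /t; lia.
rewrite lastE; clear lastE dN Ns; clearbody P s t.
split=> [[A /EP [Hp Hn] [C1 C2]] | [Hp Hw Hn A]].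
  (* The conditions extend the period [t] places to the left: place [l] before the block is [n - l]
     modulo [n]. For [l = 1] this is the flipped letter, hence the negation in [C3]. *)
  have Hpw : per u i (i + w + d - 1) d.
    move=> k hk1 hk2; case: (leqP (i + t) k) => ck; first by apply: Hp; lia.
    have t0 : 0 < t by lia.
    have [C3 C4 C5] := C2 t0.
    case: (leqP (i + t - 1) k) => ck'.
      have Ek : k = i + t - 1 by lia.
      move: C3; rewrite modE //; last by lia.
      rewrite dE; last by lia.
      have -> : i + t + (d - 1) = k + d by lia.
      move=> <-.
      have -> : i + t + (n - 1 - d) = i + t + n - 1 - d by lia.
      have <- : u (i + t + n - 1) = ~~ u (i + t + n - 1 - d) by apply/neq_bool.
      by rewrite -(un k); congr u; lia.
    have := C4 (i + t - k); rewrite modE //; last by lia.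
    rewrite modn_small; last by lia.
    rewrite dE; last by lia.
    have -> : i + t + (n - (i + t - k)) = k + n by lia.
    have -> : i + t + (d - (i + t - k)) = k + d by lia.
    by rewrite un => ->; lia.
  split=> //; last exact/EA.
    have -> : i + w - 1 = i + t + n - 1 - d by lia.
    have -> : i + t + n - 1 - d + d = i + t + n - 1 by lia.
    exact: nesym.
  have -> : i + n - 1 + d = i + (d - 1) + n by lia.
  (* For [t = 0] one letter is both the right and the left mismatch; for [t > 0] the last condition
     is the left mismatch. *)
  rewrite un; case: (posnP t) => t0.
    have := C1 t0; rewrite modE //; last by lia.
    rewrite dE; last by lia.
    have <- : i + t + (d - 1) = i + (d - 1) by lia.
    move=> <-.
    have -> : i + t + (n - 1 - d) = i + t + n - 1 - d by lia.
    by have -> : i + n - 1 = i + t + n - 1 by lia.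
  have [_ _] := C2 t0; rewrite modE //; last by lia.
  rewrite modn_small; last by lia.
  rewrite dE; last by lia.
  have -> : i + t + (n - t - 1) = i + n - 1 by lia.
  have -> : i + t + (d - t - 1) = i + (d - 1) by lia.
  by move=> /neq_bool.
have Hpt : per u (i + t) (i + t + n - 1) d by apply: perW Hp; lia.
have Hl : u (i + t + n - 1) <> u (i + t + n - 1 - d).
  have -> : i + t + n - 1 - d = i + w - 1 by lia.
  have -> : i + t + n - 1 = i + w - 1 + d by lia.
  exact: nesym.
have Hn' : u (i + n - 1) = ~~ u (i + d - 1).
  apply/neq_bool; have <- : u (i + n - 1 + d) = u (i + d - 1)
    by rewrite -(un (i + d - 1)); congr u; lia.
  exact: Hn.
split; [exact/EA | exact/EP | split=> t0].
  rewrite modE //; last by lia.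
  rewrite dE; last by lia.
  have -> : i + t + (n - 1 - d) = i + t + n - 1 - d by lia.
  have -> : i + t + (d - 1) = i + d - 1 by lia.
  move: Hl Hn'; have -> : i + t + n - 1 = i + n - 1 by lia.
  by move/neq_bool=> ->; do 2!case: (u _).
split.
- rewrite modE //; last by lia.
  rewrite dE; last by lia.
  have -> : i + t + (n - 1 - d) = i + t + n - 1 - d by lia.
  have <- : u (i + t + n - 1) = ~~ u (i + t + n - 1 - d) by apply/neq_bool.
  have -> : i + t + n - 1 = i + t - 1 + n by lia.
  have -> : i + t + (d - 1) = i + t - 1 + d by lia.
  by rewrite un Hp //; lia.
- move=> l l2 lt.
  rewrite modE //; last by lia.
  rewrite modn_small; last by lia.
  rewrite dE; last by lia.
  have -> : i + t + (n - l) = i + t - l + n by lia.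
  have -> : i + t + (d - l) = i + t - l + d by lia.
  by rewrite un Hp //; lia.
rewrite modE //; last by lia.
rewrite modn_small; last by lia.
rewrite dE; last by lia.
have -> : i + t + (n - t - 1) = i + n - 1 by lia.
by have -> : i + t + (d - t - 1) = i + d - 1 by lia.
Qed.

(** * The converse: a maximal window excludes longer repeated words *)

(** On the overlap from [s] on, Fine and Wilf give the period [gcdn d e]. If it is less than [d], it
    spreads over the first window, against primitivity; otherwise [d] divides [e] and spreads over
    the second window, which is too long. *)
Lemma windows_incompatible u w d i e j W s :
  0 < d -> 0 < e -> w <= W -> i <= s -> j <= s ->
  s + d + e <= i + w + d - 1 + gcdn d e -> s + d + e <= j + W + e + gcdn d e ->
  per u i (i + w + d - 1) d -> per u j (j + W + e) e ->
  (forall g, g %| d -> g < d -> ~ per u i (i + w + d - 1) g) ->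
  ~ per u j (j + w + d) d -> False.
Proof.
move=> d0 e0 wW is_ js h1 h2 HD HE prim nolong.
have g0 : 0 < gcdn d e by rewrite gcdn_gt0 d0.
have ge : gcdn d e <= e by apply: dvdn_leq (dvdn_gcdr _ _).
have gd : gcdn d e <= d by apply: dvdn_leq (dvdn_gcdl _ _).
set hi := minn (i + w + d - 1) (j + W + e).
have Hg : per u s hi (gcdn d e).
  apply: per_gcd => //; first by rewrite /hi; lia.
    by apply: perW HD => //; rewrite /hi; lia.
  by apply: perW HE => //; rewrite /hi; lia.
case: (ltnP (gcdn d e) d) => c.
  apply: (prim _ (dvdn_gcdl d e) c).
  by apply: (per_dvd d0 (dvdn_gcdl d e) _ _ _ HD Hg); rewrite /hi; lia.
have Eg : gcdn d e = d by lia.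
apply: nolong; rewrite Eg in Hg.
have de : d %| e by rewrite -Eg dvdn_gcdr.
have le := dvdn_leq e0 de.
have : per u j (j + W + e) d.
  by apply: (per_dvd e0 de _ _ _ HE Hg); rewrite /hi; lia.
by apply: perW; lia.
Qed.

(** The right end is kept and the run is extended to the left by the least [y] that brings it to a
    true value of [b]. *)
Lemma longest_run (b : nat -> bool) n w j : w < n ->
  (forall x, b (x + n) = b x) -> (forall k, k < w -> ~~ b (j + k)) -> b (j + w) ->
  exists j' W, [/\ j' < n, w <= W, forall k, k < W -> ~~ b (j' + k),
    b (j' + W) & b (j' + n - 1)].
Proof.
move=> wn bn H0 H1.
have bm x y : b (x %% n + y) = b (x + y).
  by rewrite -(periodic_mod (x + y) bn) -(periodic_mod (x %% n + y) bn) modnDml.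
have ex : exists k, b (j + n - 1 - k).
  by exists (n - 1 - w); have -> : j + n - 1 - (n - 1 - w) = j + w by lia.
case: (ex_minnP ex) => y Hy miny.
have ly : y <= n - 1 - w.
  by apply: miny; have -> : j + n - 1 - (n - 1 - w) = j + w by lia.
exists ((j + n - y) %% n), (w + y); split.
- by rewrite ltn_pmod //; lia.
- by lia.
- move=> k hk; rewrite bm; case: (ltnP k y) => c.
    apply/negP => Hb; have := miny (y - 1 - k).
    have -> : j + n - 1 - (y - 1 - k) = j + n - y + k by lia.
    by move=> /(_ Hb); lia.
  have -> : j + n - y + k = j + (k - y) + n by lia.
  by rewrite bn H0; lia.
- rewrite bm; have -> : j + n - y + (w + y) = j + w + n by lia.
  by rewrite bn.
- rewrite -addnBA; last by lia.
  rewrite bm; have -> : j + n - y + (n - 1) = j + n - 1 - y + n by lia.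
  by rewrite bn.
Qed.

(** Where just one of [a x] and [a (x + e)] holds, [C] puts [x] or [x + d] in the arc of [b], and
    symmetrically. At the arc ends this squeezes the parameters into a single family. *)
Lemma mismatch_arcs_incompatible (a b : nat -> bool) n w d e j W :
  0 < d -> 2 * d < n -> 0 < e -> 2 * e < n -> d <> e ->
  w < n -> 3 * n <= 4 * w + 3 -> w <= W -> j < n ->
  (forall x, a (x + n) = a x) -> (forall x, b (x + n) = b x) ->
  (forall x, a x (+) a (x + e) = b x (+) b (x + d)) ->
  (forall x, x < w - 1 -> ~~ a x) -> a (w - 1) -> a (n - 1) ->
  (forall k, k < W -> ~~ b (j + k)) -> b (j + W) -> b (j + n - 1) ->
  w < j + e -> j + w + 2 <= n + d -> False.
Proof.
move=> d0 dn e0 en de wn wL wW jn an bn C a0 aw al b0 bW bl h1 h2.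
(* These are the translates of the two arcs by multiples of [n] that can meet the range below
   [2 * n]. *)
pose inA x := w - 1 <= x < n \/ n + w - 1 <= x.
pose inB x := x < j /\ j + W <= x + n \/ j + W <= x < j + n \/ j + n + W <= x.
have A0 x : ~ inA x -> x < 2 * n -> a x = false.
  rewrite /inA => nA hx; apply/negbTE; case: (ltnP x n) => c.
    by apply: a0; case: (ltnP x (w - 1)) => // c'; case: nA; left; lia.
  rewrite -(subnK c) an; apply: a0.
  case: (ltnP x (n + w - 1)) => c'; [lia | case: nA; right; lia].
have B0 x : ~ inB x -> x < 2 * n -> b x = false.
  rewrite /inB => nB hx; apply/negbTE; case: (ltnP x j) => c.
    rewrite -bn; have -> : x + n = j + (x + n - j) by lia.
    by apply: b0; case: (leqP (j + W) (x + n)) => c'; [case: nB; left | lia].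
  case: (ltnP x (j + n)) => c1.
    rewrite -(subnKC c); apply: b0.
    case: (leqP (j + W) x) => c'; [case: nB; right; left; lia | lia].
  have <- : j + (x - n - j) + n = x by lia.
  rewrite bn; apply: b0.
  case: (leqP (j + n + W) x) => c'; [case: nB; right; right; lia | lia].
have fromA x : a x != a (x + e) -> x + d < 2 * n -> inB x \/ inB (x + d).
  move=> H hx; apply: NNPP => N; move: H (C x).
  by rewrite (B0 x) ?(B0 (x + d)); first [lia | tauto].
have fromB x : b x != b (x + d) -> x + e < 2 * n -> inA x \/ inA (x + e).
  move=> H hx; apply: NNPP => N; move: H (C x).
  by rewrite (A0 x) ?(A0 (x + e)); first [lia | tauto].
have s1 : inB (n - 1) \/ inB (n - 1 + d).
  apply: fromA; last by lia.
  by rewrite al A0 // /inA; lia.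
have s2 : inB (w - 1 - e) \/ inB (w - 1 - e + d).
  apply: fromA; last by lia.
  rewrite A0; [|rewrite /inA; lia | lia].
  have -> : w - 1 - e + e = w - 1 by lia.
  by rewrite aw.
have [t1 t2 t3 t4] : [/\ d <= j, j + e < n, j + W + e < n + w & j + W < n + d].
  by rewrite /inB in s1 s2; split; lia.
have em : e + w <= n.
  case: (leqP (e + w) n) => // c.
  have : inB (n - 1 - e) \/ inB (n - 1 - e + d).
    apply: fromA; last by lia.
    rewrite A0; [|rewrite /inA; lia | lia].
    have -> : n - 1 - e + e = n - 1 by lia.
    by rewrite al.
  by rewrite /inB; lia.
have t5 : n <= d + W by lia.
have t6 : n <= j + W by lia.
have t7 : j + W + e + 1 = n + w.
  have : inA (j + W - n) \/ inA (j + W - n + e).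
    apply: fromB; last by lia.
    rewrite -bn; have -> : j + W - n + n = j + W by lia.
    by rewrite bW B0 // /inB; lia.
  by rewrite /inA; lia.
have bl' : b (j - 1).
  by rewrite -bn (_ : j - 1 + n = j + n - 1) //; lia.
have t8 : j = d.
  case: (leqP j d) => c; first by lia.
  have : inA (j - 1 - d) \/ inA (j - 1 - d + e).
    apply: fromB; last by lia.
    rewrite B0; [|rewrite /inB; lia | lia].
    have -> : j - 1 - d + d = j - 1 by lia.
    by rewrite bl'.
  by rewrite /inA; lia.
(* Here [n = 4 * e - 3], [w = 3 * e - 3], [d = 2 * e - 2]: the arc ends alone are
   consistent, and it takes two more positions, [w - e] and [w]. *)
have [f1 f2 f3 f4] :
    [/\ 2 * d + 1 = n, e + w = n, n = W + 2 & n + 3 = 4 * e] by split; lia.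
have aw' : a w.
  have := C (w - e).
  have -> : w - e + e = w by lia.
  have -> : w - e = j - 1 by lia.
  rewrite bl' (A0 (j - 1)); [|rewrite /inA; lia|lia].
  by rewrite (B0 (j - 1 + d)); [|rewrite /inB; lia|lia].
have := C w; rewrite aw'.
have -> : w + e = 0 + n by lia.
rewrite an (A0 0); [|rewrite /inA; lia|lia].
rewrite (B0 w); [|rewrite /inB; lia|lia].
by rewrite (B0 (w + d)); [|rewrite /inB; lia|lia].
Qed.

Lemma per_shift u n lo hi p : (forall i, u (i + n) = u i) ->
  per u (n + lo) (n + hi) p <-> per u lo hi p.
Proof.
move=> un; split=> H k hk1 hk2.
  by rewrite -un -(un k) -addnA (addnC p) addnA H //; lia.
have <- : k - n + n = k by lia.
by rewrite -addnA (addnC n) addnA !un H //; lia.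
Qed.

(** Modulo [n], the mismatches at [w - 1] and [n - 1] are separated by gaps [n - w] and [w], both at
    most [w]. *)
Lemma mismatch_in_window (a : nat -> bool) n w x : 0 < w -> w < n -> n <= 2 * w ->
  (forall x, a (x + n) = a x) -> a (w - 1) -> a (n - 1) ->
  exists2 k, x <= k < x + w & a k.
Proof.
move=> w0 wn nw an aw al; have n0 : 0 < n by lia.
have aM q k : a (k + q * n) = a k := periodic_addM k q an.
have lx := ltn_pmod x n0.
rewrite (divn_eq x n); move: (x %/ n) (x %% n) lx => q r lt.
case: (ltnP r w) => c; [exists (w - 1 + q * n) | exists (n - 1 + q * n)];
  rewrite ?aM //; move: (q * n) => m; lia.
Qed.

Lemma core0_determines u n w d : 0 < w < n -> 3 * n <= 4 * w + 3 ->
  (forall i, u (i + n) = u i) -> 0 < d -> 2 * d <= n ->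
  core u n w 0 d -> determines u w.
Proof.
move=> /andP [w0 wn] wL un d0 dn [HD Hw Hl prim].
have n0 : 0 < n by lia.
rewrite !add0n in HD Hw Hl prim.
apply: NNPP => /(not_determines_shift n0 un) [j0 [e [e0 en He De]]].
have nw : n <= 2 * w by lia.
have dw : d <= w by lia.
have ew : e <= w by lia.
pose a x := u x (+) u (x + d); pose b x := u x (+) u (x + e).
have an x : a (x + n) = a x by rewrite /a addnAC !un.
have bn x : b (x + n) = b x by rewrite /b addnAC !un.
have xorP (x y : bool) : x (+) y <-> x <> y by case: x; case: y.
have a0 x : x < w - 1 -> ~~ a x.
  by move=> hx; rewrite /a HD ?addbb //; lia.
have aw : a (w - 1) by apply/xorP.
have al : a (n - 1) by apply/xorP.
have [j [W [jn wW b0 bW bl]]] : exists j' W, [/\ j' < n, w <= W,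
    forall k, k < W -> ~~ b (j' + k), b (j' + W) & b (j' + n - 1)].
  apply: (longest_run (j := j0)) => // [k hk|]; last by apply/xorP.
  by rewrite /b He ?addbb //; lia.
have HE : per u j (j + W + e) e.
  move=> k hk1 hk2; have := b0 (k - j); rewrite subnKC // /b.
  move=> H; apply/esym/eqP/negPn/negP => /eqP /xorP; apply/negP/H.
  by move: hk1 hk2; clear; lia.
have nolong x : ~ per u x (x + w + d) d.
  move=> H; have [k /andP [hk1 hk2]] := mismatch_in_window x w0 wn nw an aw al.
  by rewrite /a H ?addbb // ltn_add2r.
have g0 : 0 < gcdn d e by rewrite gcdn_gt0 d0.
(* The second window is compared with the first one at [0], then with its copy at [n]. If both
   overlaps are too short for Fine and Wilf, the arcs decide. *)
case: (leqP (w + gcdn d e) (j + e)) => c1; last first.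
  by apply: (windows_incompatible (s := j) d0 e0 wW _ _ _ _ HD HE) => //;
    move: (gcdn d e) c1 wW dw d0; clear; lia.
case: (leqP (n + d) (j + w + gcdn d e)) => c2.
  have Esh : n + w + d - 1 = n + (w + d - 1) by move: d0; clear; lia.
  apply: (windows_incompatible (i := n) (s := n) d0 e0 wW _ _ _ _ _ HE) => //.
  - by move: jn; clear; lia.
  - by move: (gcdn d e) ew d0 g0; clear; lia.
  - by move: (gcdn d e) c2 wW; clear; lia.
  - by rewrite Esh -{1}(addn0 n) per_shift.
  - by move=> g gd lt; rewrite Esh -{1}(addn0 n) per_shift //; exact: prim.
have de : d <> e.
  by move=> E; move: c1 c2 wL wn w0; rewrite -E gcdnn; clear; lia.
(* If [2 * d = n], then [a] has period [d], and the mismatch at [n - 1] recurs at [d - 1], inside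
   the window. *)
have dn' : 2 * d < n.
  rewrite ltn_neqAle dn andbT; apply/eqP => E.
  have d1 : d - 1 < w - 1.
    by move: (gcdn d e) g0 c1 c2 wL E dw d0 en; clear; lia.
  case/negP: (a0 _ d1).
  rewrite /a addbC -(un (d - 1)).
  have -> : d - 1 + n = n - 1 + d by move: d0 n0; clear; lia.
  have -> : d - 1 + d = n - 1 by move: d0 E; clear; lia.
  exact: al.
have en' : 2 * e < n.
  rewrite ltn_neqAle en andbT; apply/eqP => E.
  have e1 : e - 1 < W by move: ew wW e0; clear; lia.
  case/negP: (b0 _ e1).
  rewrite /b addbC -(un (j + (e - 1))).
  have -> : j + (e - 1) + n = j + n - 1 + e by move: e0 n0; clear; lia.
  have -> : j + (e - 1) + e = j + n - 1 by move: e0 E; clear; lia.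
  exact: bl.
apply: (@mismatch_arcs_incompatible a b n w d e j W) => //.
- by move=> x; rewrite /a /b (addnAC x e d); do 4!case: (u _).
- by move: (gcdn d e) c1 g0; clear; lia.
- by move: (gcdn d e) c2 g0; clear; lia.
Qed.

Lemma core_determines u n w i d : 0 < w < n -> 3 * n <= 4 * w + 3 ->
  (forall i, u (i + n) = u i) -> 0 < d -> 2 * d <= n ->
  core u n w i d -> determines u w.
Proof.
move=> wn wL un d0 dn [H1 H2 H3 H4].
pose v x := u (i + x).
have vP hi p : per v 0 hi p <-> per u i (i + hi) p.
  split=> H k hk1 hk2; last by rewrite /v addnA H //; lia.
  have := H (k - i) isT; rewrite /v addnA subnKC //; apply; lia.
have Hv : determines v w.
  apply: (core0_determines wn wL _ d0 dn) => [k|]; first by rewrite /v addnA un.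
  have E : i + (0 + w + d - 1) = i + w + d - 1 by lia.
  split=> [|||g gd lt]; rewrite ?vP ?E //; last exact: H4.
    rewrite /v; have -> : i + (0 + w - 1) = i + w - 1 by lia.
    by have -> : i + (0 + w - 1 + d) = i + w - 1 + d by lia.
  rewrite /v; have -> : i + (0 + n - 1) = i + n - 1 by lia.
  by have -> : i + (0 + n - 1 + d) = i + n - 1 + d by lia.
have uv x k : u (x + k) = v (x + (i * n - i) + k).
  have -> : v (x + (i * n - i) + k) = u (x + k + i * n) by rewrite /v; congr u; nia.
  by rewrite periodic_addM.
by move=> x y H; rewrite !uv; apply: Hv => k hk; rewrite -!uv H.
Qed.

Lemma core_not_determines u n w i d : 0 < w -> 0 < d ->
  core u n w i d -> ~ determines u (w - 1).
Proof.
move=> w0 d0 [H1 H2 _ _] H; apply: H2.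
have -> : i + w - 1 = i + (w - 1) by lia.
rewrite addnAC; apply: H => k hk.
by rewrite (addnAC i d) H1 //; lia.
Qed.

Theorem theorem2 (n w : nat) (u : nat -> bool) :
  0 < n -> 0 < w -> (3 * n) %/ 4 <= w -> w <= n - 1 ->
  least_period u n ->
  (nlc_is u w <->
   exists k : nat, form_i n w (block u k n) \/ form_ii n w (block u k n)).
Proof.
move=> n0 w0 wL wn Hu; have [_ [un _]] := Hu.
have wL' : 3 * n <= 4 * w + 3 by lia.
have wn' : 0 < w < n by lia.
rewrite (nlc_isP n0 w0 un).
have -> : determines u w /\ ~ determines u (w - 1) <->
    exists i d, [/\ 0 < d, 2 * d <= n & core u n w i d].
  split=> [[]|[i [d [d0 dn H]]]]; first exact: nlc_core.
  by split; [apply: core_determines H | apply: core_not_determines H].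
split=> [[i [d [d0 dn H]]] | [k [[d [d0 dn A E]] | [d [d1 d2 A E1 E2]]]]].
- case: (ltnP (w + d) n) => c.
    exists i; left; exists d.
    by have [A E] := (form_iP i w0 d0 c un).2 H; split=> //; lia.
  exists (i + (w + d - n)); right; exists d.
  by have [A E1 E2] := (form_iiP i wn' d0 dn c un).2 H; split=> //; lia.
- exists k, d; split=> //; first by lia.
  by apply/(form_iP k w0 d0 _ un); [lia | split].
- have d0 : 0 < d by lia.
  have dn : 2 * d <= n by lia.
  have nwd : n <= w + d by lia.
  (* The window starts [w + d - n] places before the block; adding [n] keeps the subtraction
     exact. *)
  exists (k + n - (w + d - n)), d; split=> //.
  have EB : block u (k + n - (w + d - n) + (w + d - n)) n = block u k n.
    rewrite subnK; last by lia.
    by apply: eq_map => x; rewrite addnAC un.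
  by apply/(form_iiP _ wn' d0 dn nwd un); rewrite EB; split.
Qed.
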